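(* Let $R$ be a Noetherian local UFD with maximal ideal $\mathfrak{m}$ and field of fractions $K$, complete for the $\mathfrak{m}$-adic topology, such that the characteristic of $R/\mathfrak{m}$ is not $2$. Let $V$ be a two-dimensional $K$-vector space and $\rho:G\to\mathrm{Aut}_K(V)$ an irreducible representation of a group $G$ such that $V$ contains a $G$-stable lattice which is free over $R$, and such that $\mathrm{tr}\,\rho\bmod\mathfrak{m}=\psi+\psi'$ for distinct characters $\psi,\psi':G\to(R/\mathfrak{m})^\times$. Then every $G$-stable reflexive lattice of $V$ is free over $R$.
   Context: A lattice in $V$ is a finitely generated $R$-submodule of $V$ spanning $V$ over $K$; it is reflexive if the canonical map to its double $R$-linear dual is an isomorphism. *)

(* Defs.v *)
From HB Require Import structures.
From mathcomp Require Import all_boot all_order all_algebra.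
From mathcomp Require Import generic_quotient ring_quotient fraction.
From mathcomp Require Import boolp functions.

Set Implicit Arguments.
Unset Strict Implicit.
Unset Printing Implicit Defensive.

Import GRing.Theory.
Local Open Scope ring_scope.
Local Open Scope quotient_scope.

(* Submodules and ideals are the boolean predicates of ssralg ([submodClosed])
   and ring_quotient ([idealr], proper ideals).  In the classical setting of
   boolp every Prop-valued predicate is of this form. *)

Section Modules.
Variables (R : comNzRingType) (M : lmodType R).

Definition submod_type (N : submodClosed M) : Type := {x : M | x \in N}.

HB.instance Definition _ (N : submodClosed M) := SubChoice.on (submod_type N).
HB.instance Definition _ (N : submodClosed M) :=
  [SubChoice_isSubLmodule of submod_type N by <:].

Definition finitely_generated (N : submodClosed M) : Prop :=
  exists2 s : seq M, {subset s <= N} &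
    forall x, x \in N ->
      exists c : 'I_(size s) -> R, x = \sum_i c i *: s`_i.

(* Freeness of finite rank; this is the only case that can occur for finitely
   generated modules, as R is nonzero. *)
Definition free_module : Prop :=
  exists n, exists f : {linear M -> 'rV[R]_n}, bijective f.

Definition linear_pred : {pred M -> R^o} := fun f => `[< linear f >].

Lemma linear_pred_submod_closed : submod_closed linear_pred.
Proof.
split=> [|a f g /asboolP lf /asboolP lg].
  by apply/asboolP => b x y /=; rewrite scaler0 addr0.
apply/asboolP => b x y; rewrite !fctE lf lg.
by rewrite !scalerDr !scalerA (mulrC a b) addrACA.
Qed.

HB.instance Definition _ :=
  GRing.isSubmodClosed.Build R (M -> R^o) linear_pred linear_pred_submod_closed.

End Modules.

Definition dual (R : comNzRingType) (M : lmodType R) : lmodType R :=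
  submod_type (@linear_pred R M).

Section Reflexive.
Variables (R : comNzRingType) (M : lmodType R).

Definition bidual_fun (x : M) : dual M -> R^o := fun f => val f x.

Lemma bidual_fun_linear (x : M) : bidual_fun x \in @linear_pred R (dual M).
Proof. by apply/asboolP. Qed.

Definition to_bidual (x : M) : dual (dual M) :=
  exist _ (bidual_fun x) (bidual_fun_linear x).

Definition reflexive_module : Prop := bijective to_bidual.

End Reflexive.

Section Rings.
Variable R : idomainType.

Definition noetherian : Prop :=
  forall I : submodClosed R^o, finitely_generated I.

Definition maximal_ideal (m : idealr R) : Prop :=
  forall I : idealr R, {subset m <= I} -> {subset I <= m}.

Definition local_with (m : idealr R) : Prop :=
  maximal_ideal m /\ forall m' : idealr R, maximal_ideal m' -> m' =i m.

Definition irreducible_elt (p : R) : Prop :=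
  [/\ p != 0, p \isn't a GRing.unit &
      forall a b, p = a * b -> a \is a GRing.unit \/ b \is a GRing.unit].

Definition associated (a b : R) : Prop :=
  exists2 u, u \is a GRing.unit & b = u * a.

Definition ufd : Prop :=
  (forall x : R, x != 0 -> x \isn't a GRing.unit ->
     exists2 s : seq R,
       forall p, p \in s -> irreducible_elt p & x = \prod_(p <- s) p) /\
  (forall s t : seq R,
     (forall p, p \in s -> irreducible_elt p) ->
     (forall p, p \in t -> irreducible_elt p) ->
     associated (\prod_(p <- s) p) (\prod_(p <- t) p) ->
     exists t' : seq R,
       [/\ perm_eq t t', size s = size t' &
           forall i, (i < size s)%N -> associated s`_i t'`_i]).

Fixpoint ideal_pow (m : idealr R) (n : nat) (x : R) : Prop :=
  if n is n'.+1 then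
    exists2 s : seq (R * R),
      forall p, p \in s -> p.1 \in m /\ ideal_pow m n' p.2 &
      x = \sum_(p <- s) p.1 * p.2
  else True.

Definition adic_cauchy (m : idealr R) (u : nat -> R) : Prop :=
  forall n, exists N, forall i j,
    (N <= i)%N -> (N <= j)%N -> ideal_pow m n (u i - u j).

Definition adic_cvg (m : idealr R) (u : nat -> R) (l : R) : Prop :=
  forall n, exists N, forall i, (N <= i)%N -> ideal_pow m n (u i - l).

(* "Complete" includes "separated". *)
Definition adic_complete (m : idealr R) : Prop :=
  (forall x, (forall n, ideal_pow m n x) -> x = 0) /\
  (forall u, adic_cauchy m u -> exists l, adic_cvg m u l).

End Rings.

(* Restriction of scalars along R -> Frac R. *)
Definition restr (R : idomainType) (V : lmodType {fraction R}) : Type := V.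

Section Restriction.
Variables (R : idomainType) (V : lmodType {fraction R}).

HB.instance Definition _ := GRing.Zmodule.on (restr V).

Definition restr_scale (a : R) (v : restr V) : restr V :=
  tofrac a *: (v : V).

Fact restr_scaleA a b v :
  restr_scale a (restr_scale b v) = restr_scale (a * b) v.
Proof. by rewrite /restr_scale scalerA -tofracM. Qed.

Fact restr_scale1 : left_id 1 restr_scale.
Proof. by move=> v; rewrite /restr_scale tofrac1 scale1r. Qed.

Fact restr_scaleDr : right_distributive restr_scale +%R.
Proof. by move=> a u v; rewrite /restr_scale scalerDr. Qed.

Fact restr_scaleDl v : {morph restr_scale^~ v : a b / a + b}.
Proof. by move=> a b; rewrite /restr_scale tofracD scalerDl. Qed.

HB.instance Definition _ := GRing.Zmodule_isLmodule.Build R (restr V)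
  restr_scaleA restr_scale1 restr_scaleDr restr_scaleDl.

End Restriction.

Section Representations.
Variables (R : idomainType) (V : vectType {fraction R}) (G : groupType).

Definition lattice (L : submodClosed (restr V)) : Prop :=
  finitely_generated L /\
  forall v : V, exists2 s : seq V, {subset s <= L} & v \in <<s>>%VS.

(* The values are automatically automorphisms, G being a group. *)
Definition representation (rho : G -> 'End(V)) : Prop :=
  rho 1%g = \1%VF /\ forall g h, rho (g * h)%g = (rho g \o rho h)%VF.

Definition irreducible_repr (rho : G -> 'End(V)) : Prop :=
  (fullv : {vspace V}) <> 0%VS /\
  forall W : {vspace V}, (forall g, (rho g @: W <= W)%VS) ->
    W = 0%VS \/ W = fullv.

Definition stable (rho : G -> 'End(V)) (L : submodClosed (restr V)) : Prop :=
  forall g (v : V), v \in L -> rho g v \in L.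

Definition lftrace (f : 'End(V)) : {fraction R} :=
  \tr (passmx.mxof (vbasis fullv) (vbasis fullv) f).

(* Characters G -> A^*: the values are automatically units, G being a group. *)
Definition unit_character (A : comNzRingType) (psi : G -> A) : Prop :=
  psi 1%g = 1 /\ forall g h, psi (g * h)%g = psi g * psi h.

(* The trace takes values in R and its reduction mod m is psi + psi'. *)
Definition trace_mod (m : idealr R) (rho : G -> 'End(V))
    (psi psi' : G -> {ideal_quot m}) : Prop :=
  forall g, exists2 t : R,
    lftrace (rho g) = tofrac t & \pi_{ideal_quot m} t = psi g + psi' g.

End Representations.

(* Main.v *)
Require Import Defs.
From HB Require Import structures.
From mathcomp Require Import all_boot all_order all_algebra.
From mathcomp Require Import generic_quotient ring_quotient fraction.
From mathcomp Require Import boolp functions ring.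

Set Implicit Arguments.
Unset Strict Implicit.
Unset Printing Implicit Defensive.

Import GRing.Theory passmx.
Local Open Scope ring_scope.
Local Open Scope quotient_scope.

(** A single element of the group decomposes every stable lattice.  Choose g
with psi g <> psi' g.  Since 2 is invertible in R, the determinant
(tr(g)^2 - tr(g^2)) / 2 of rho g lies in R, and the characteristic polynomial
of rho g reduces mod m to (X - psi g)(X - psi' g), which has two distinct
roots.  By Hensel's lemma it splits over R with roots that differ by a unit, so
the projector p of V onto one eigenline along the other is an R-linear
combination of rho g and the identity ([split_coefficients],
[idempotent_of_quadratic]).

Hence p maps every stable lattice L to itself, and L is the direct sum of its
intersections with the two lines limg p and lker p
([idempotent_split_free]).  If L is reflexive, each of these intersections is a
saturated submodule of rank one of a reflexive module over a UFD, hence free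
([saturated_rank1_cyclic]): a linear form identifies it with an ideal
of R, whose generators have a greatest common divisor c; reflexivity says that
an element y divisible by r under every linear form is itself divisible by r
([reflexive_div]), and this makes the element corresponding to c available
in L. *)

(** * Divisibility in a UFD *)

Definition rdvd (R : comNzRingType) (a b : R) : Prop := exists c, b = c * a.

Section UFD.
Variable R : idomainType.
Hypothesis R_ufd : ufd R.

Lemma ufd_factor (x : R) : x != 0 ->
  exists u, exists s : seq R,
    [/\ u \is a GRing.unit, forall p, p \in s -> irreducible_elt p
      & x = u * \prod_(p <- s) p].
Proof.
move=> x0; have [xu|xnu] := boolP (x \is a GRing.unit).
  by exists x, [::]; split=> //; rewrite big_nil mulr1.
have [s hs ->] := R_ufd.1 x x0 xnu.
by exists 1, s; split; rewrite ?unitr1 ?mul1r.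
Qed.

Lemma associated_unitMl (u a b : R) :
  u \is a GRing.unit -> associated a (u * b) -> associated a b.
Proof.
move=> uu [v vu e]; exists (u^-1 * v); first by rewrite unitrM unitrV uu.
by rewrite -mulrA -e mulKr.
Qed.

(** Writing u * prod s = c * p and factoring c gives two factorizations, one of
which contains p; uniqueness matches p with an entry of the other. *)
Lemma irreducible_dvd_prod (p : R) (s : seq R) (u : R) :
  irreducible_elt p -> (forall q, q \in s -> irreducible_elt q) ->
  u \is a GRing.unit -> rdvd p (u * \prod_(q <- s) q) ->
  exists2 q, q \in s & associated p q.
Proof.
move=> irrp irrs uu [c e]; have [p0 pnu _] := irrp.
have c0 : c != 0.
  have : u * \prod_(q <- s) q != 0.
    rewrite mulf_neq0 //; first by apply: contraTneq uu => ->; rewrite unitr0.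
    by rewrite prodf_seq_neq0; apply/allP => q /irrs[].
  by rewrite e; apply: contraNneq => ->; rewrite mul0r.
have [v [t [vu irrt ec]]] := ufd_factor c0.
have irrpt q : q \in p :: t -> irreducible_elt q.
  by rewrite inE => /orP[/eqP -> //|/irrt].
have ass : associated (\prod_(q <- p :: t) q) (\prod_(q <- s) q).
  apply: (@associated_unitMl u) => //; exists v => //.
  by rewrite e ec big_cons; ring.
have [s' [pe es as0]] := R_ufd.2 _ _ irrpt irrs ass.
exists s'`_0; last exact: (as0 0%N).
by rewrite (perm_mem pe) mem_nth // -es.
Qed.

Lemma irreducible_prime (p a b : R) :
  irreducible_elt p -> rdvd p (a * b) -> rdvd p a \/ rdvd p b.
Proof.
move=> irrp pab.
have [->|a0] := eqVneq a 0; first by left; exists 0; rewrite mul0r.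
have [->|b0] := eqVneq b 0; first by right; exists 0; rewrite mul0r.
have [u [s [uu irrs ea]]] := ufd_factor a0.
have [v [t [vu irrt eb]]] := ufd_factor b0.
have [||||q qst [w wu eq_q]] := @irreducible_dvd_prod p (s ++ t) (u * v).
- by [].
- by move=> q; rewrite mem_cat => /orP[/irrs|/irrt].
- by rewrite unitrM uu.
- suff <- : a * b = u * v * \prod_(q <- s ++ t) q by [].
  by rewrite ea eb big_cat /=; ring.
move: qst; rewrite mem_cat => /orP[qs|qt]; [left|right].
  exists (u * w * \prod_(r <- rem q s) r).
  by rewrite ea (big_rem q qs) /= eq_q; ring.
exists (v * w * \prod_(r <- rem q t) r).
by rewrite eb (big_rem q qt) /= eq_q; ring.
Qed.

(** In a UFD this says that 1 is a greatest common divisor of the family;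
divisors are tested on irreducibles so that arguments can remove one factor
at a time. *)
Definition coprime_family (I : Type) (a : I -> R) : Prop :=
  forall p, irreducible_elt p -> ~ forall i, rdvd p (a i).

(** One nonzero member suffices to bound the process of dividing out common
irreducible factors: each of them occurs in the factorization of a j, so the
induction is on the number of factors of a j. *)
Lemma ufd_family_gcd (I : Type) (a : I -> R) (j : I) : a j != 0 ->
  exists c, exists a' : I -> R,
    [/\ c != 0, forall i, a i = c * a' i & coprime_family a'].
Proof.
move=> /ufd_factor[u [s [uu irrs ea]]].
elim: {s}(size s) {-2}s (erefl (size s)) => [|n IHn] s size_s
  in a u uu irrs ea *.
  exists 1, a; split=> [|i|p irrp pa]; rewrite ?oner_eq0 ?mul1r //.
  have := pa j; rewrite ea => /(irreducible_dvd_prod irrp irrs uu)[q].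
  by rewrite (size0nil size_s).
have [[p irrp pa]|nop] := pselect (exists2 p, irreducible_elt p &
    forall i, rdvd p (a i)); last first.
  exists 1, a; split=> [|i|p irrp pa]; rewrite ?oner_eq0 ?mul1r //.
  by apply: nop; exists p.
have [b eb] := choice pa; have [p0 _ _] := irrp.
have := pa j; rewrite ea.
move=> /(irreducible_dvd_prod irrp irrs uu)[q qs [v vu eq_q]].
have size_rem_s : size (rem q s) = n by rewrite size_rem // size_s.
have [|||c [a' [c0 ea' cop]]] := IHn (rem q s) size_rem_s b (u * v).
- by rewrite unitrM uu.
- by move=> r /mem_rem/irrs.
- apply: (mulIf p0); rewrite -eb ea (big_rem q qs) /= eq_q; ring.
exists (c * p), a'; split=> // [|i]; first by rewrite mulf_neq0.
by rewrite eb ea'; ring.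
Qed.

(** Gauss's argument: an irreducible factor p of r fails to divide some a i, so
it divides b, and both r and b can be divided by p. *)
Lemma coprime_family_dvd (I : Type) (a : I -> R) (r b : R) :
  coprime_family a -> r != 0 -> (forall i, rdvd r (a i * b)) -> rdvd r b.
Proof.
move=> cop /ufd_factor[u [s [uu irrs ->]]].
elim: s b irrs => [|p s IHs] b irrs rab.
  by exists (b * u^-1); rewrite big_nil mulr1 divrK.
have irrp := irrs p (mem_head p s); have [p0 _ _] := irrp.
have pb : rdvd p b.
  have [//|npb] := pselect (rdvd p b); case: (cop p irrp) => i.
  have [|//|//] := @irreducible_prime p (a i) b irrp.
  have [c ->] := rab i; rewrite big_cons.
  by exists (c * u * \prod_(q <- s) q); ring.
case: pb => c eb; have [||d ec] := IHs c.
- by move=> q qs; apply: irrs; rewrite inE qs orbT.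
- move=> i; have [d e] := rab i; exists d; apply: (mulIf p0).
  by rewrite -mulrA -eb e big_cons; ring.
by exists d; rewrite eb ec big_cons; ring.
Qed.

End UFD.

(** * Saturated rank-one submodules of a reflexive module *)

Section ReflexiveModules.
Variables (R : idomainType) (M : lmodType R).
Hypothesis M_refl : reflexive_module M.

Lemma dual_linear (f : dual M) : linear (val f : M -> R^o).
Proof. exact/asboolP/(valP f). Qed.

Lemma dual0 (f : dual M) : val f 0 = 0.
Proof.
by have := dual_linear f (-1) 0 0; rewrite scaler0 addr0 scaleN1r addNr.
Qed.

Lemma dualZ (f : dual M) a x : val f (a *: x) = a * val f x.
Proof.
by have := dual_linear f a x 0; rewrite addr0 dual0 addr0.
Qed.

Lemma dual_addZ a (f g : dual M) x :
  val (a *: f + g) x = a * val f x + val g x.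
Proof.
by rewrite (@GRing.linearP R (dual M) (M -> R^o) _ (val : {linear _ -> _})).
Qed.

Lemma dual_sep x y : (forall f : dual M, val f x = val f y) -> x = y.
Proof.
move=> e; apply: (bij_inj M_refl); apply: val_inj.
by apply: funext => f; apply: e.
Qed.

Lemma reflexive_torsion_free a (x y : M) : a != 0 -> a *: x = a *: y -> x = y.
Proof.
move=> a0 e; apply: dual_sep => f; apply: (mulfI a0).
by rewrite -!dualZ e.
Qed.

(** The quotients f y / r depend linearly on f, so they define a point of the
bidual, which comes from an element x; then r *: x and y have the same image in
the bidual. *)
Lemma reflexive_div (r : R) (y : M) : r != 0 ->
  (forall f : dual M, rdvd r (val f y)) -> exists x, y = r *: x.
Proof.
move=> r0 /choice[phi ephi].
have phi_lin : (phi : dual M -> R^o) \in @linear_pred R (dual M).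
  apply/asboolP => a f g; apply: (mulIf r0); rewrite -ephi.
  by rewrite dual_addZ !ephi mulrDl -mulrA.
have [inv _ invK] := M_refl.
pose Phi : dual (dual M) :=
  @exist _ (fun h => h \in @linear_pred R (dual M)) phi phi_lin.
exists (inv Phi); apply: dual_sep => f.
rewrite dualZ ephi mulrC; congr (_ * _).
by have /(congr1 val)/(congr1 (fun h => h f)) := invK Phi.
Qed.

(** A linear form f with f x0 != 0 is injective on the rank-one N and sends it
to an ideal.  Dividing the values of f on N by their gcd c leaves a coprime
family a, with a(x0) *: y = a(y) *: x0.  Applying any form h gives
a(x0) | a(y) h(x0) for all y, hence a(x0) | h(x0), so that x0 = a(x0) *: w for
some w; as N is saturated, w lies in N, and y = a(y) *: w for all y in N. *)
Lemma saturated_rank1_cyclic (R_ufd : ufd R) (N : M -> Prop) (x0 : M) :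
  (forall r x, r != 0 -> N (r *: x) -> N x) ->
  N x0 -> x0 != 0 ->
  (forall y, N y -> exists a b, a != 0 /\ a *: y = b *: x0) ->
  exists w, [/\ N w, w != 0 & forall y, N y -> exists c, y = c *: w].
Proof.
move=> satN Nx0 x0_neq0 rank1.
(* Linear forms separate points because the map to the bidual is injective. *)
have [f fx0] : exists f : dual M, val f x0 != 0.
  apply: contrapT => nof; move/eqP: x0_neq0; apply; apply: dual_sep => f.
  by rewrite dual0; apply: contrapT => /eqP fx0; apply: nof; exists f.
have exch y : N y -> val f x0 *: y = val f y *: x0.
  move=> /rank1[a [b [a0 e]]]; apply: (reflexive_torsion_free a0).
  rewrite scalerA mulrC -scalerA e !scalerA; congr (_ *: _).
  by rewrite -dualZ e dualZ mulrC.
pose I := {y | N y}.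
have [c [a [c0 ea cop]]] :=
  @ufd_family_gcd R R_ufd I (fun y => val f (sval y)) (exist _ x0 Nx0) fx0.
set i0 : I := exist _ x0 Nx0 in ea *.
have {}exch (i : I) : a i0 *: sval i = a i *: x0.
  apply: (reflexive_torsion_free c0); rewrite !scalerA -!ea.
  exact: exch (svalP i).
have ai0 : a i0 != 0.
  by move: fx0; rewrite (ea i0); apply: contraNneq => ->; rewrite mulr0.
have [w ew] : exists w, x0 = a i0 *: w.
  apply: reflexive_div => // h; apply: (coprime_family_dvd R_ufd cop ai0) => i.
  by exists (val h (sval i)); rewrite -dualZ -exch dualZ mulrC.
exists w; split.
- by apply: satN ai0 _; rewrite -ew.
- by apply: contraNneq x0_neq0 => w0; rewrite ew w0 scaler0.
move=> y Ny; exists (a (exist _ y Ny)); apply: (reflexive_torsion_free ai0).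
by rewrite (exch (exist _ y Ny)) {1}ew !scalerA mulrC.
Qed.

End ReflexiveModules.

(** * Complete local rings *)

Section Adic.
Variables (R : idomainType) (m : idealr R).

Lemma ideal_powD n x y :
  ideal_pow m n x -> ideal_pow m n y -> ideal_pow m n (x + y).
Proof.
case: n => [//|n] [s hs ->] [t ht ->]; exists (s ++ t); last by rewrite big_cat.
by move=> p; rewrite mem_cat => /orP[/hs|/ht].
Qed.

Lemma ideal_powMl n a x : ideal_pow m n x -> ideal_pow m n (a * x).
Proof.
case: n => [//|n] [s hs ->]; exists [seq (a * p.1, p.2) | p <- s].
  by move=> _ /mapP[p /hs[p1 p2] ->]; split=> //=; apply: idealMr.
by rewrite big_map mulr_sumr; apply: eq_bigr => p _ /=; rewrite mulrA.
Qed.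

Lemma ideal_powB n x y :
  ideal_pow m n x -> ideal_pow m n y -> ideal_pow m n (x - y).
Proof.
move=> hx hy; apply: ideal_powD => //.
by rewrite -mulN1r; apply: ideal_powMl.
Qed.

Lemma ideal_powS_mul n a x :
  a \in m -> ideal_pow m n x -> ideal_pow m n.+1 (a * x).
Proof.
move=> am xm; exists [:: (a, x)]; last by rewrite big_seq1.
by move=> p; rewrite inE => /eqP ->.
Qed.

Lemma ideal_powW n x : ideal_pow m n.+1 x -> ideal_pow m n x.
Proof.
move=> [s hs ->]; rewrite big_seq; apply: (big_ind (ideal_pow m n)).
- by case: n {hs} => [//|n]; exists [::]; rewrite ?big_nil.
- exact: ideal_powD.
- by move=> p /hs[_ p2]; apply: ideal_powMl.
Qed.

Lemma ideal_pow1 x : ideal_pow m 1 x <-> x \in m.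
Proof.
split=> [[s hs ->]|xm].
  by rewrite big_seq rpred_sum // => p /hs[p1 _]; rewrite mulrC idealMr.
by rewrite -[x]mulr1; apply: ideal_powS_mul.
Qed.

Hypothesis R_complete : adic_complete m.

(** The contraction principle: the iterates of F from 0 form a Cauchy sequence,
and its limit is fixed because F is continuous. *)
Lemma adic_fixpoint (F : R -> R) :
  (forall x, x \in m -> F x \in m) ->
  (forall n x y, x \in m -> y \in m -> ideal_pow m n (x - y) ->
     ideal_pow m n.+1 (F x - F y)) ->
  exists2 x, x \in m & F x = x.
Proof.
move=> Fm Fc; pose u k := iter k F 0.
have um k : u k \in m by elim: k => [|k IHk]; [rewrite rpred0 | apply: Fm].
have du n k : ideal_pow m n (u (n + k)%N - u n).
  by elim: n => [//|n IHn]; rewrite addSn; apply: Fc.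
have cu : adic_cauchy m u.
  move=> n; exists n => i j /subnKC <- /subnKC <-.
  by rewrite -(subrKA (u n)) -[u n - _]opprB; apply: ideal_powB.
have [l cl] := R_complete.2 u cu.
have lm : l \in m.
  have [N /(_ N (leqnn N))/ideal_pow1 hN] := cl 1%N.
  by rewrite -[l](subKr (u N)) rpredB.
exists l => //; apply/eqP; rewrite -subr_eq0; apply/eqP/R_complete.1 => n.
have [N hN] := cl n.
rewrite -[F l](subrK (F (u N))) -addrA; apply: ideal_powD; last first.
  exact: (hN N.+1 (leqnSn N)).
apply/ideal_powW/Fc => //; rewrite -opprB -mulN1r.
exact: ideal_powMl (hN N (leqnn N)).
Qed.

Lemma unit_1Bm t : t \in m -> 1 - t \is a GRing.unit.
Proof.
move=> tm; have [|n x y _ _ xy|x _ ex] := @adic_fixpoint (fun x => t + t * x).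
- by move=> x _; rewrite rpredD // mulrC idealMr.
- by rewrite opprD addrACA subrr add0r -mulrBr; apply: ideal_powS_mul.
apply/unitrP; exists (1 + x).
suff e : (1 - t) * (1 + x) = 1 by rewrite mulrC e.
have -> : (1 - t) * (1 + x) = 1 + (x - (t + t * x)) by ring.
by rewrite ex subrr addr0.
Qed.

(** The case of Hensel's lemma needed here: X^2 - X + e reduces to X(X - 1), and
z is the fixed point of the map x |-> e + x^2, a contraction on m. *)
Lemma adic_quadratic_root e :
  e \in m -> exists2 z, z \in m & z ^+ 2 - z + e = 0.
Proof.
move=> em.
have [x xm|n x y xm ym xy|z zm ez] := @adic_fixpoint (fun x => e + x ^+ 2).
- by rewrite rpredD // expr2 idealMr.
- rewrite opprD addrACA subrr add0r subr_sqr mulrC.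
  by apply: ideal_powS_mul => //; rewrite rpredD.
by exists z => //; rewrite -[in - z]ez; ring.
Qed.

Hypothesis R_local : local_with m.

(** If x is not in m, the ideal m + (x) strictly contains the maximal ideal m,
so it contains 1, and r x = 1 - a with a in m is a unit. *)
Lemma unit_notin_max x : x \notin m -> x \is a GRing.unit.
Proof.
move=> xm.
pose S := [pred y | `[< exists2 a, a \in m & exists r, y = a + r * x >]].
have mS : {subset m <= S}.
  by move=> y ym; apply/asboolP; exists y => //; exists 0; rewrite mul0r addr0.
have [/asboolP[a am [r e]]|S1] := boolP (1 \in S).
  have : r * x \is a GRing.unit.
    by rewrite (_ : r * x = 1 - a) ?unit_1Bm // e addrC addKr.
  by rewrite unitrM => /andP[].
have S_ideal : idealr_closed S.
  split=> // [|a y z /asboolP[b bm [r ->]] /asboolP[c cm [s ->]]].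
    exact: mS (rpred0 _).
  apply/asboolP; exists (a * b + c); first by rewrite rpredD // idealMr.
  by exists (a * r + s); ring.
pose SI : idealr R := HB.pack (S : R -> bool) (isIdealr.Build R S S_ideal).
case/negP: xm; apply: (R_local.1 SI mS x).
by apply/asboolP; exists 0; [rewrite rpred0 | exists 1; rewrite mul1r add0r].
Qed.

(** Here t and d stand for the trace and the determinant of an endomorphism f of
a plane, and b, t - b for approximate eigenvalues with distinct reductions.
With u the inverse of t - 2b, the endomorphism h = u (f - b) has trace 1 and
determinant e = u^2 (d - (t - b) b) in m, so its eigenvalues are z and 1 - z
for a root z in m of X^2 - X + e.  The projector onto the (1 - z)-eigenline is
(h - z) / (1 - 2z), that is al f - be with the coefficients chosen below; the
two equations say that it has trace 1 and determinant 0. *)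
Lemma split_coefficients t d b :
  t - 2%:R * b \notin m -> d - (t - b) * b \in m ->
  exists al be, al * t = 1 + 2%:R * be /\ be ^+ 2 + be = al ^+ 2 * d.
Proof.
move=> /unit_notin_max tb db.
pose u := (t - 2%:R * b)^-1; have eu : u * (t - 2%:R * b) = 1 by rewrite mulVr.
have [z zm ez] := adic_quadratic_root (idealMr (u ^+ 2) db).
have wu : 1 - 2%:R * z \is a GRing.unit by rewrite unit_1Bm // idealMr.
pose w := (1 - 2%:R * z)^-1; have ew : w * (1 - 2%:R * z) = 1 by rewrite mulVr.
exists (w * u), (w * (u * b + z)); split.
  have -> : w * u * t = w * (u * (t - 2%:R * b)) + 2%:R * (w * (u * b)) by ring.
  rewrite eu; have -> : w * 1 = w * (1 - 2%:R * z) + 2%:R * (w * z) by ring.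
  by rewrite ew; ring.
set be := w * (u * b + z).
have -> : be ^+ 2 + be = be * (be + w * (1 - 2%:R * z)) by rewrite ew; ring.
have -> : be * (be + w * (1 - 2%:R * z)) =
    w ^+ 2 * ((u * b) ^+ 2 + u * b * 1 + (z - z ^+ 2)) by rewrite /be; ring.
have -> : z - z ^+ 2 = u ^+ 2 * (d - (t - b) * b).
  by apply/eqP; rewrite -subr_eq0 -oppr_eq0 -ez; apply/eqP; ring.
have -> : u * b * 1 = u * b * (u * (t - 2%:R * b)) by rewrite eu.
ring.
Qed.

End Adic.

(** * Endomorphisms of a plane *)

(** The determinant is expressed through the traces of A and A^2, the only
invariants controlled by the character of a representation; the factor 2 avoids
division. *)
Lemma Cayley_Hamilton2 (R : comNzRingType) n (A : 'M[R]_n) : n = 2%N ->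
  2%:R *: (A *m A) =
    (2%:R * \tr A) *: A - ((\tr A) ^+ 2 - \tr (A *m A))%:M.
Proof.
move=> n2; move: A; rewrite n2 => A; apply/matrixP => i j.
rewrite !mxE /mxtrace !big_ord_recl !big_ord0 !mxE !big_ord_recl !big_ord0.
case: (unliftP ord0 i) => [i'|] ->; case: (unliftP ord0 j) => [j'|] ->.
all: rewrite ?[i']ord1 ?[j']ord1 /=; ring.
Qed.

Lemma Cayley_Hamilton2_lfun (F : fieldType) (V : vectType F) (f : 'End(V)) v :
  \dim (fullv : {vspace V}) = 2%N -> 2%:R != 0 :> F ->
  let tr h := \tr (mxof (vbasis fullv) (vbasis fullv) h) in
  f (f v) = tr f *: f v - ((tr f ^+ 2 - tr (f \o f)%VF) / 2%:R) *: v.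
Proof.
move=> dimV nz2 tr; have bV := vbasisP (fullv : {vspace V}).
have := Cayley_Hamilton2 (mxof (vbasis fullv) (vbasis fullv) f) dimV.
rewrite -mxof_comp // -/(tr f) -/(tr (f \o f)%VF).
set D := (X in X%:M); set c := 2%:R * _.
rewrite -scalemx1 -(mxof1 (basis_free bV)).
move/(congr1 (hommx (vbasis fullv) (vbasis fullv))) => e.
rewrite linearB !linearZ /= !mxofK // in e; move/lfunP/(_ v): e => e.
rewrite !(comp_lfunE, add_lfunE, opp_lfunE, scale_lfunE, id_lfunE) in e.
apply: (scalerI nz2); rewrite e scalerN scalerBr !scalerA; congr (_ - _ *: _).
by rewrite mulrC divfK.
Qed.

Section IdempotentOfPlane.
Variables (F : fieldType) (V : vectType F).
Hypothesis dimV : \dim (fullv : {vspace V}) = 2%N.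

Lemma idempotent_of_quadratic (f : 'End(V)) (t d al be : F) :
  (forall v, f (f v) = t *: f v - d *: v) ->
  al * t = 1 + 2%:R * be -> be ^+ 2 + be = al ^+ 2 * d ->
  let p := al *: f - be *: \1%VF in forall v, p (p v) = p v.
Proof.
move=> ff e1 e2 p v.
have pE u : p u = al *: f u - be *: u.
  by rewrite /p !(add_lfunE, opp_lfunE, scale_lfunE, id_lfunE).
rewrite [p (p v)]pE pE linearB /= ![f (_ *: _)]linearZ /= ff.
rewrite !scalerBr !scalerA.
rewrite [in LHS]opprB [LHS](AC (3*2) ((1*3*5)*(4*2)))/= -!scalerBl.
congr (_ *: _ + _); last rewrite -scaleNr; last congr (_ *: _).
  by rewrite -mulrA e1; ring.
have -> : al * al * d = be ^+ 2 + be by rewrite e2; ring.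
ring.
Qed.

Lemma idempotent_dim1 (p : 'End(V)) :
  (forall v, p (p v) = p v) -> p != 0 -> p != \1%VF ->
  \dim (limg p) = 1%N /\ \dim (lker p) = 1%N.
Proof.
move=> pp p0 p1.
have := limg_ker_dim p fullv; rewrite dimV capfv.
have : \dim (limg p) != 0%N.
  rewrite dimv_eq0; apply: contra p0 => /eqP l0; apply/eqP/lfunP => v.
  by apply/eqP; rewrite lfunE /= -memv0 -l0 memv_img ?memvf.
have : \dim (lker p) != 0%N.
  rewrite dimv_eq0; apply: contra p1 => /eqP l0; apply/eqP/lfunP => v.
  apply/eqP; rewrite lfunE /= eq_sym -subr_eq0 -memv0 -l0 memv_ker.
  by rewrite linearB /= pp subrr.
by case: (\dim _) => [|[|[|?]]] //; case: (\dim _) => [|[|[|?]]].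
Qed.

End IdempotentOfPlane.

(** * Lattices in a plane *)

Lemma fraction_quotient (R : idomainType) (k : {fraction R}) :
  exists n d, d != 0 /\ tofrac d * k = tofrac n.
Proof.
elim/quotW: k => x; exists \n_x, \d_x; split; first exact: denom_ratioP.
apply/eqP; rewrite piE /= /FracField.equivf /FracField.mulf.
rewrite !numden_Ratio ?mulf_neq0 ?denom_ratioP ?oner_eq0 //.
by apply/eqP; ring.
Qed.

Section ReflexiveLattices.
Variables (R : idomainType) (V : vectType {fraction R}).
Variable L : submodClosed (restr V).
Implicit Types (v w : V) (f : 'End(V)).

(** Otherwise the kernel of f would contain L, which spans V. *)
Lemma lattice_detects f :
  lattice L -> f != 0 -> exists2 v : V, v \in L & f v != 0.
Proof.
move=> [_ spanL]; apply: contraNP => nov.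
apply/eqP/lfunP => v; rewrite lfunE /=.
have [s sL vs] := spanL v; apply/eqP; rewrite -memv_ker.
apply: subvP vs; apply/span_subvP => w /sL wL.
by rewrite memv_ker; apply: contrapT => /negP fw; apply: nov; exists w.
Qed.

(** The intersection of L with a line W of V is saturated in L, and two vectors
of a line are proportional over R after clearing the denominator of their
ratio. *)
Lemma reflexive_meets_line_cyclic (W : {vspace V}) (x0 : V) :
  ufd R -> reflexive_module (submod_type L) ->
  \dim W = 1%N -> x0 \in L -> x0 \in W -> x0 != 0 ->
  exists w : V, [/\ w \in L, w \in W, w != 0 &
    forall y : V, y \in L -> y \in W -> exists c : R, y = tofrac c *: w].
Proof.
move=> R_ufd L_refl dimW x0L x0W x0_neq0.
pose x0' : submod_type L := exist _ (x0 : restr V) x0L.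
have [|||y yW|[w wL] [/= wW w0 wgen]] :=
  @saturated_rank1_cyclic R (submod_type L) L_refl R_ufd
    (fun y => (val y : V) \in W) x0'.
- move=> r x r0 rxW.
  have /(memvZ (tofrac r)^-1) : tofrac r *: (val x : V) \in W by [].
  by rewrite scalerK // tofrac_eq0.
- by [].
- by apply: contra_neq x0_neq0 => /(congr1 val).
- have [k ky] : exists k, (val y : V) = k *: x0.
    apply/vlineP; suff -> : (<[x0]> = W)%VS by [].
    by apply/eqP; rewrite eqEdim dimW dim_vline x0_neq0 -memvE x0W.
  have [n [d [d0 e]]] := fraction_quotient k; exists d, n; split=> //.
  apply: val_inj; suff: tofrac d *: (val y : V) = tofrac n *: x0 by [].
  by rewrite -e -scalerA -ky.
exists w; split=> // y yL yW.
have [c /(congr1 val) /= ec] := wgen (exist _ (y : restr V) yL) yW.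
by exists c.
Qed.

End ReflexiveLattices.

Lemma free_module_of_basis2 (R : comNzRingType) (M : lmodType R) (w1 w2 : M) :
  (forall a b, a *: w1 + b *: w2 = 0 -> a = 0 /\ b = 0) ->
  (forall y, exists a b, y = a *: w1 + b *: w2) ->
  free_module M.
Proof.
move=> indep gen.
have /choice[cf ecf] y : exists c : R * R, y = c.1 *: w1 + c.2 *: w2.
  by have [a [b e]] := gen y; exists (a, b).
pose g (u : 'rV[R]_2) := u 0 0 *: w1 + u 0 1 *: w2.
pose f y : 'rV[R]_2 := \row_j (if j == 0 then (cf y).1 else (cf y).2).
have fK : cancel f g by move=> y; rewrite /g !mxE -ecf.
have g_lin : linear g.
  by move=> a u v; rewrite /g !mxE !scalerDl scalerDr !scalerA addrACA.
have g_inj : injective g.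
  move=> u v e; apply/eqP; rewrite -subr_eq0; apply/eqP.
  have : g (u - v) = 0.
    by rewrite -[u - v]addrC -scaleN1r g_lin e scaleN1r addNr.
  move=> /indep[u0 u1]; apply/rowP => j; rewrite [RHS]mxE.
  case: (unliftP 0 j) => [j'|] -> //; rewrite (_ : lift _ _ = 1) //.
  by apply: val_inj; rewrite [j']ord1.
have gK : cancel g f by move=> u; apply: g_inj; rewrite fK.
have f_lin : linear f by move=> a x y; apply: g_inj; rewrite g_lin !fK.
pose fL : {linear M -> 'rV[R]_2} :=
  HB.pack f (GRing.isLinear.Build R M 'rV[R]_2 *:%R f f_lin).
by exists 2%N, fL; exists g.
Qed.

Lemma submod_combination (R : comNzRingType) (M : lmodType R)
    (L : submodClosed M) (a b : R) (x y : M) :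
  x \in L -> y \in L -> a *: x - b *: y \in L.
Proof. by move=> xL yL; rewrite -scaleNr rpredD ?rpredZ. Qed.

Lemma lattice_combination (R : idomainType) (V : vectType {fraction R})
    (L : submodClosed (restr V)) (a b : R) (v w : V) :
  v \in L -> w \in L -> tofrac a *: v - tofrac b *: w \in L.
Proof. exact: (@submod_combination R (restr V) L a b v w). Qed.

(** L is the direct sum of its images under p and 1 - p, which are its
intersections with the lines limg p and lker p. *)
Lemma idempotent_split_free (R : idomainType) (V : vectType {fraction R})
    (L : submodClosed (restr V)) (p : 'End(V)) :
  ufd R -> lattice L -> reflexive_module (submod_type L) ->
  \dim (fullv : {vspace V}) = 2%N ->
  (forall v, p (p v) = p v) -> p != 0 -> p != \1%VF ->
  (forall v : V, v \in L -> p v \in L) ->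
  free_module (submod_type L).
Proof.
move=> R_ufd Llat Lrefl dimV pp p0 p1 pL.
have [dim1 dim2] := idempotent_dim1 dimV pp p0 p1.
have pim v : v \in limg p -> p v = v by move=> /memv_imgP[u _ ->].
have [x1 x1L px1] := lattice_detects Llat p0.
have [w1 [w1L w1W w1_neq0 w1gen]] := reflexive_meets_line_cyclic R_ufd Lrefl
  dim1 (pL _ x1L) (memv_img p (memvf x1)) px1.
have q0 : \1%VF - p != 0 by rewrite subr_eq0 eq_sym.
have qE v : (\1%VF - p) v = v - p v by rewrite add_lfunE opp_lfunE id_lfunE.
have [x2 x2L] := lattice_detects Llat q0; rewrite qE => qx2.
have qL v : v \in L -> v - p v \in L.
  by move=> vL; have := lattice_combination 1 1 vL (pL v vL); rewrite !scale1r.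
have qker v : v - p v \in lker p by rewrite memv_ker linearB /= pp subrr.
have [w2 [w2L w2W w2_neq0 w2gen]] := reflexive_meets_line_cyclic R_ufd Lrefl
  dim2 (qL _ x2L) (qker x2) qx2.
have {}w2W : p w2 = 0 by apply/eqP; rewrite -memv_ker.
have {}w1W := pim _ w1W.
pose W1 : submod_type L := exist _ (w1 : restr V) w1L.
pose W2 : submod_type L := exist _ (w2 : restr V) w2L.
apply: (@free_module_of_basis2 _ _ W1 W2) => [a b|[y yL]].
  move=> /(congr1 val) ab.
  have {}ab : tofrac a *: w1 + tofrac b *: w2 = 0 by [].
  have := congr1 p ab.
  rewrite linearD !linearZ /= w1W w2W scaler0 addr0 linear0 => a0.
  move: ab; rewrite a0 add0r => /eqP; move/eqP: a0.
  rewrite !scaler_eq0 !tofrac_eq0 (negPf w1_neq0) (negPf w2_neq0) !orbF.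
  by move=> /eqP -> /eqP ->.
have [a ea] := w1gen (p y) (pL _ yL) (memv_img p (memvf y)).
have [b eb] := w2gen _ (qL _ yL) (qker y).
exists a, b; apply: val_inj.
suff : (y : V) = tofrac a *: w1 + tofrac b *: w2 by [].
by rewrite -ea -eb addrC subrK.
Qed.

Lemma pi_eq0 (R : comNzRingType) (m : idealr R) x :
  (\pi_{ideal_quot m} x == 0) = (x \in m).
Proof.
rewrite -[x in RHS]subr0 Quotient.idealrBE.
by rewrite -(rmorph0 (\pi_{ideal_quot m})).
Qed.

Theorem proposition3p6 (R : idomainType) (m : idealr R)
    (R_noetherian : noetherian R) (R_local : local_with m) (R_ufd : ufd R)
    (R_complete : adic_complete m)
    (char_neq2 : 2%N \notin [pchar {ideal_quot m}])
    (V : vectType {fraction R}) (dimV : \dim (fullv : {vspace V}) = 2%N)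
    (G : groupType) (rho : G -> 'End(V))
    (rho_repr : representation rho) (rho_irr : irreducible_repr rho)
    (free_lattice : exists L : submodClosed (restr V),
       [/\ lattice L, stable rho L & free_module (submod_type L)])
    (psi psi' : G -> {ideal_quot m})
    (psi_char : unit_character psi) (psi'_char : unit_character psi')
    (psi_neq : psi <> psi')
    (trace_eq : trace_mod rho psi psi') :
  forall L : submodClosed (restr V),
    lattice L -> stable rho L -> reflexive_module (submod_type L) ->
    free_module (submod_type L).
Proof.
move=> L Llat Lst Lrefl.
have [g psig] : exists g, psi g != psi' g.
  apply: contrapT => noq; apply: psi_neq; apply: funext => g.
  by apply: contrapT => /eqP ng; apply: noq; exists g.
have [t et pit] := trace_eq g.
have [t2 et2 pit2] := trace_eq (g * g)%g.
have nm2 : 2%:R \notin m by move: char_neq2; rewrite inE /= -pi_eq0 rmorph_nat.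
have u2 : 2%:R \is a GRing.unit := unit_notin_max R_complete R_local nm2.
(* b lifts psi' g, and t - b then lifts psi g, so that t - 2b lifts
   psi g - psi' g. *)
pose b := repr (psi' g).
have pib : \pi_{ideal_quot m} b = psi' g by rewrite reprK.
(* d is the determinant of rho g. *)
pose d := (t ^+ 2 - t2) / 2%:R.
have ed : d * 2%:R = t ^+ 2 - t2 by rewrite divrK.
have pisum : t - 2%:R * b \notin m.
  rewrite -pi_eq0 rmorphB rmorphM rmorph_nat /= pit pib.
  rewrite (_ : _ - _ = psi g - psi' g) ?subr_eq0 //; ring.
have db : d - (t - b) * b \in m.
  have : (d - (t - b) * b) * 2%:R \in m.
    rewrite mulrBl ed -pi_eq0 !(rmorphB, rmorphM, rmorphXn) rmorph_nat /=.
    rewrite pit pit2 pib psi_char.2 psi'_char.2; apply/eqP; ring.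
  by move=> /(idealMr 2%:R^-1); rewrite mulrC mulrK.
have [al [be [e1 e2]]] := split_coefficients R_complete R_local pisum db.
pose f := rho g; pose p := tofrac al *: f - tofrac be *: \1%VF : 'End(V).
have nz2 : 2%:R != 0 :> {fraction R}.
  rewrite -(rmorph_nat (@FracField.tofrac R)) tofrac_eq0.
  by apply: contraNneq nm2 => ->; rewrite rpred0.
have CH v : f (f v) = tofrac t *: f v - tofrac d *: v.
  rewrite (Cayley_Hamilton2_lfun f v dimV nz2).
  rewrite -/(lftrace f) -/(lftrace (f \o f)%VF) -rho_repr.2 et et2.
  rewrite -tofracXn -tofracB -ed tofracM rmorph_nat.
  by rewrite mulfK.
have [e1' e2'] : tofrac al * tofrac t = 1 + 2%:R * tofrac be /\
    tofrac be ^+ 2 + tofrac be = tofrac al ^+ 2 * tofrac d.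
  split; last by rewrite -!tofracXn -tofracD -tofracM e2.
  by rewrite -tofracM e1 rmorphD rmorphM rmorph1 rmorph_nat.
(* An idempotent of trace 1 in dimension 2 is neither 0 nor the identity. *)
have trp : lftrace p = 1.
  rewrite /lftrace /p linearB !linearZ /= mxof1 ?(basis_free (vbasisP _)) //.
  rewrite scalerN linearB /= !mxtraceZ -/(lftrace f) et mxtrace1 dimV.
  by rewrite e1'; ring.
apply: (@idempotent_split_free _ _ _ p) => //.
- exact: idempotent_of_quadratic CH e1' e2'.
- apply/eqP => p0; move: trp; rewrite p0 /lftrace !linear0 => /eqP.
  by rewrite eq_sym oner_eq0.
- apply/eqP => p1; move: trp; rewrite p1 /lftrace.
  rewrite mxof1 ?(basis_free (vbasisP _)) // mxtrace1 dimV => /eqP.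
  rewrite -subr_eq0 -[X in _ - X]/(1%:R) -natrB //.
  by rewrite oner_eq0.
move=> v vL; rewrite /p add_lfunE opp_lfunE !scale_lfunE id_lfunE.
by apply: lattice_combination => //; apply: Lst.
Qed.
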